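(* Let $K$ be a field of characteristic zero, $n\geq 1$, and $k\in K^n$. Let $A_n^k$ be the $n$th hom-associative Weyl algebra over $K$. Then: (i) $C(A_n^k)=K$. (ii) $N(A_n^k)=N_l(A_n^k)=N_m(A_n^k)=N_r(A_n^k)$, and this set equals $A_n^k$ if $k=0$ and $\{0\}$ otherwise. (iii) $Z(A_n^k)=K$ if $k=0$, and $Z(A_n^k)=\{0\}$ otherwise.
   Context: The $n$th Weyl algebra $A_n$ over $K$ is the free associative unital $K$-algebra on $x_1,\ldots,x_n,y_1,\ldots,y_n$ modulo the relations $[x_i,x_j]=[y_i,y_j]=0$ and $[x_i,y_j]=\delta_{ij}$ (Kronecker delta, times $1_{A_n}$) for $1\le i,j\le n$. For $k=(k_1,\ldots,k_n)\in K^n$, let $\widehat\alpha_k\colon A_n\to A_n$ be the unital $K$-algebra endomorphism with $\widehat\alpha_k(x_\ell)=x_\ell$ and $\widehat\alpha_k(y_\ell)=y_\ell+k_\ell$ for $1\le\ell\le n$. The $n$th hom-associative Weyl algebra $A_n^k$ is the $K$-vector space $A_n$ equipped with the (in general nonassociative, nonunital) multiplication $p*q:=\widehat\alpha_k(pq)$ (where $pq$ is the product in $A_n$) and with twisting map $\widehat\alpha_k$. Here $K$ is identified with $K1_{A_n}\subseteq A_n$. For a nonassociative algebra $A$, let $[a,b]=ab-ba$ and $(a,b,c)=(ab)c-a(bc)$. The commuter is $C(A)=\{a\in A\mid [a,b]=0 \text{ for all } b\in A\}$. The left, middle and right nuclei are $N_l(A)=\{a\mid (a,b,c)=0\ \forall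 b,c\in A\}$, $N_m(A)=\{b\mid (a,b,c)=0\ \forall a,c\in A\}$, $N_r(A)=\{c\mid (a,b,c)=0\ \forall a,b\in A\}$. The nucleus is $N(A)=N_l(A)\cap N_m(A)\cap N_r(A)$, and the center is $Z(A)=C(A)\cap N(A)$. *)

(* Defs.v *)
(* MathComp, with the sets of mathcomp-classical and the monoid algebras of
   multinomials. *)
From HB Require Import structures.
From mathcomp Require Import all_boot all_order all_algebra.
From mathcomp Require Import boolp classical_sets.
From mathcomp Require mpoly.
From mathcomp Require Import finmap monalg.

Set Implicit Arguments.
Unset Strict Implicit.
Unset Printing Implicit Defensive.

Import GRing.Theory.
Local Open Scope ring_scope.
Local Open Scope quotient_scope.

Lemma malg_scalerAr (R : comNzRingType) (M : monomType) (c : R)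
  (f g : {malg R[M]}) : c *: (f * g) = f * (c *: g).
Proof.
apply/malgP => w; have le := msuppZ_le c g.
rewrite (mcoeffMlw w (fsubset_refl (msupp f)) le) mcoeffZ mcoeffMl mulr_sumr.
apply: eq_bigr => w1 _; rewrite mulr_sumr; apply: eq_bigr => w2 _.
by rewrite mcoeffZ mulrnAr mulrCA.
Qed.

(* The free associative unital K-algebra on I is the monoid algebra of the free
   monoid {fmonom I} of words in I. *)
Section FreeAlgebra.
Variables (K : fieldType) (I : choiceType).

Definition freeAlg : Type := {malg K[{fmonom I}]}.
HB.instance Definition _ := GRing.Lalgebra.on freeAlg.

HB.instance Definition _ :=
  GRing.Lalgebra_isAlgebra.Build K freeAlg (@malg_scalerAr K _).

Definition freeGen (i : I) : freeAlg := << fmu i >>.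

Section Action.
Variables (V : lmodType K) (g : I -> {linear V -> V}).

Definition wordAct (w : {fmonom I}) (v : V) : V :=
  foldr (fun i u => g i u) v (w : seq I).

Definition freeAct (f : freeAlg) (v : V) : V :=
  \sum_(w <- msupp f) f@_w *: wordAct w v.

Lemma wordAct_linear w : linear (wordAct w).
Proof.
move=> c u v; rewrite /wordAct; elim: (w : seq I) => //= i s ->.
by rewrite linearP.
Qed.
HB.instance Definition _ w :=
  GRing.isLinear.Build K V V *:%R (wordAct w) (wordAct_linear w).

Lemma freeActEw (d : {fset {fmonom I}}) f v : fsubset (msupp f) d ->
  freeAct f v = \sum_(w <- d) f@_w *: wordAct w v.
Proof.
move=> le; rewrite [LHS](big_fset_incl _ le) => //= w _ /mcoeff_outdom ->.
by rewrite scale0r.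
Qed.

Lemma freeAct_linear f : linear (freeAct f).
Proof.
move=> c u v; rewrite /freeAct scaler_sumr -big_split /=.
by apply: eq_bigr => w _; rewrite linearP scalerDr !scalerA mulrC.
Qed.
HB.instance Definition _ f :=
  GRing.isLinear.Build K V V *:%R (freeAct f) (freeAct_linear f).

Lemma freeActD f1 f2 v : freeAct (f1 + f2) v = freeAct f1 v + freeAct f2 v.
Proof.
have le1 := fsubsetUl (msupp f1) (msupp f2).
have le2 := fsubsetUr (msupp f1) (msupp f2).
rewrite (freeActEw _ le1) (freeActEw _ le2) (freeActEw _ (msuppD_le _ _)).
by rewrite -big_split /=; apply: eq_bigr => w _; rewrite mcoeffD scalerDl.
Qed.

Lemma freeAct0 v : freeAct 0 v = 0.
Proof. by apply: (addrI (freeAct 0 v)); rewrite -freeActD !addr0. Qed.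

Lemma freeActN f v : freeAct (- f) v = - freeAct f v.
Proof. by apply: (addrI (freeAct f v)); rewrite -freeActD !subrr freeAct0. Qed.

Lemma freeActU (c : K) w v : freeAct (<< c *g w >> : {malg _[_]}) v = c *: wordAct w v.
Proof. by rewrite (freeActEw _ msuppU_le) big_seq_fset1 mcoeffUU. Qed.

Lemma freeAct_sum (T : Type) (r : seq T) (F : T -> freeAlg) v :
  freeAct (\sum_(i <- r) F i) v = \sum_(i <- r) freeAct (F i) v.
Proof.
by apply: (big_morph (freeAct^~ v) _ (freeAct0 v)) => f1 f2; rewrite freeActD.
Qed.

Lemma freeAct1 v : freeAct 1 v = v.
Proof. by rewrite freeActU scale1r /wordAct fm1. Qed.

Lemma freeActM f1 f2 v : freeAct (f1 * f2) v = freeAct f1 (freeAct f2 v).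
Proof.
rewrite malgME freeAct_sum; apply: eq_bigr => w1 _.
rewrite freeAct_sum /= {2}/freeAct linear_sum scaler_sumr; apply: eq_bigr => w2 _.
by rewrite freeActU linearZ scalerA /wordAct fmM foldr_cat.
Qed.

Lemma freeActG i v : freeAct (freeGen i) v = g i v.
Proof. by rewrite freeActU scale1r /wordAct fmU. Qed.

End Action.

Section Eval.
Variables (S : algType K) (g : I -> S).

Definition freeEval (f : freeAlg) : S :=
  \sum_(w <- msupp f) f@_w *: \prod_(i <- (w : seq I)) g i.

Let freeEvalE f v : freeEval f * v = freeAct (fun i => g i \*o idfun) f v.
Proof.
rewrite /freeEval mulr_suml; apply: eq_bigr => w _.
rewrite -scalerAl; congr (_ *: _); rewrite /wordAct.
elim: (w : seq I) => [|i s IH] /=; first by rewrite big_nil mul1r.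
by rewrite big_cons -mulrA IH.
Qed.

Lemma freeEval_is_monoid_morphism : monoid_morphism freeEval.
Proof.
split; first by rewrite -[LHS]mulr1 freeEvalE freeAct1.
by move=> f1 f2; rewrite -[LHS]mulr1 freeEvalE freeActM -!freeEvalE mulr1.
Qed.

Lemma freeEval_is_linear : linear freeEval.
Proof.
move=> c f1 f2; rewrite -[LHS]mulr1 freeEvalE freeActD -!freeEvalE !mulr1.
congr (_ + _); have -> : c *: f1 = (c%:MP : freeAlg) * f1 by rewrite mul_malgC.
rewrite (freeEval_is_monoid_morphism.2) -[freeEval (malgC c)]mulr1.
by rewrite freeEvalE freeActU /wordAct fm1 /= -scalerAl mul1r.
Qed.
HB.instance Definition _ :=
  GRing.isLinear.Build K freeAlg S *:%R freeEval freeEval_is_linear.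
HB.instance Definition _ :=
  GRing.isMonoidMorphism.Build freeAlg S freeEval freeEval_is_monoid_morphism.

Lemma freeEvalG i : freeEval (freeGen i) = g i.
Proof. by rewrite -[LHS]mulr1 freeEvalE freeActG /= mulr1. Qed.

End Eval.
End FreeAlgebra.

Definition comm (R : pzRingType) (a b : R) : R := a * b - b * a.

Lemma rmorph_comm (R S : pzRingType) (f : {rmorphism R -> S}) (a b : R) :
  f (comm a b) = comm (f a) (f b).
Proof. by rewrite /comm rmorphB !rmorphM. Qed.
Lemma commDr (K : pzRingType) (A : algType K) (a b : A) (c : K) :
  comm a (b + c%:A) = comm a b.
Proof.
by rewrite /comm mulrDr mulrDl mulr_algr mulr_algl opprD addrACA subrr addr0.
Qed.
Lemma commDl (K : pzRingType) (A : algType K) (a b : A) (c : K) :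
  comm (a + c%:A) b = comm a b.
Proof.
by rewrite /comm mulrDr mulrDl mulr_algr mulr_algl opprD addrACA subrr addr0.
Qed.

Lemma mulrBM (R : pzRingType) (a b c d : R) :
  a * b - c * d = (a - c) * b + c * (b - d).
Proof. by rewrite mulrBl mulrBr addrA subrK. Qed.

Section Weyl.
Variables (K : fieldType) (n : nat).

Definition weylFree : Type := freeAlg K ('I_n + 'I_n)%type.
HB.instance Definition _ := GRing.Algebra.on weylFree.

Definition freeX (i : 'I_n) : weylFree := freeGen K (inl i).
Definition freeY (i : 'I_n) : weylFree := freeGen K (inr i).

Inductive weylRelator : weylFree -> Prop :=
| WeylXX i j : weylRelator (comm (freeX i) (freeX j))
| WeylYY i j : weylRelator (comm (freeY i) (freeY j))
| WeylXY i j : weylRelator (comm (freeX i) (freeY j) - (i == j)%:R).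

Inductive weylIdeal : weylFree -> Prop :=
| WeylIdealRel r of weylRelator r : weylIdeal r
| WeylIdeal0 : weylIdeal 0
| WeylIdealD f g of weylIdeal f & weylIdeal g : weylIdeal (f + g)
| WeylIdealMl f g of weylIdeal g : weylIdeal (f * g)
| WeylIdealMr f g of weylIdeal f : weylIdeal (f * g).

Definition weylIdealb (f : weylFree) : bool := `[< weylIdeal f >].

Lemma weylIdealb_zmod_closed : zmod_closed weylIdealb.
Proof.
split; first exact/asboolP/WeylIdeal0.
move=> f g /asboolP If /asboolP Ig; apply/asboolP/WeylIdealD => //.
by rewrite -mulN1r; apply: WeylIdealMl.
Qed.
HB.instance Definition _ :=
  GRing.isZmodClosed.Build weylFree weylIdealb weylIdealb_zmod_closed.

Definition weylIdealZ : zmodClosed weylFree :=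
  GRing.ZmodClosed.clone weylFree weylIdealb _.

Definition weyl : Type := Quotient.quot weylIdealZ.
HB.instance Definition _ := GRing.Zmodule.on weyl.

Definition weylPi (f : weylFree) : weyl := \pi_(Quotient.quot weylIdealZ) f.
Definition weylRepr (a : weyl) : weylFree :=
  repr (a : Quotient.quot weylIdealZ).

Lemma weylReprK : cancel weylRepr weylPi. Proof. exact: reprK. Qed.

Lemma weylPiP f g : weylPi f = weylPi g <-> weylIdeal (f - g).
Proof.
have := Quotient.idealrBE weylIdealZ f g.
rewrite unfold_in /= /weylIdealb => E; split.
  by move=> /eqP; rewrite -E => /asboolP.
by move=> /asboolP; rewrite E => /eqP.
Qed.

Lemma weylPiK f : weylIdeal (weylRepr (weylPi f) - f).
Proof. by apply/weylPiP; rewrite weylReprK. Qed.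

Lemma weylPiD f g : weylPi (f + g) = weylPi f + weylPi g.
Proof. exact: Quotient.pi_add. Qed.

Definition weyl1 : weyl := weylPi 1.
(* [locked] here only stops conversion from unfolding into the quotient. *)
Definition weylMul : weyl -> weyl -> weyl :=
  locked (fun a b => weylPi (weylRepr a * weylRepr b)).
Definition weylScale : K -> weyl -> weyl :=
  locked (fun c a => weylPi (c *: weylRepr a)).

Lemma weylMulPi f g : weylMul (weylPi f) (weylPi g) = weylPi (f * g).
Proof.
rewrite /weylMul -lock; apply/weylPiP; rewrite mulrBM.
by apply: WeylIdealD; [apply: WeylIdealMr|apply: WeylIdealMl]; apply: weylPiK.
Qed.

Lemma weylScalePi c f : weylScale c (weylPi f) = weylPi (c *: f).
Proof.
by rewrite /weylScale -lock; apply/weylPiP; rewrite -scalerBr -mulr_algl; apply/WeylIdealMl/weylPiK.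
Qed.

Let weyl_ind (P : weyl -> Prop) : (forall f, P (weylPi f)) -> forall a, P a.
Proof. by move=> Pf a; rewrite -(weylReprK a). Qed.

Lemma weylMulA : associative weylMul.
Proof. by do 3!elim/weyl_ind=> ?; rewrite !weylMulPi mulrA. Qed.
Lemma weylMul1l : left_id weyl1 weylMul.
Proof. by elim/weyl_ind=> ?; rewrite weylMulPi mul1r. Qed.
Lemma weylMul1r : right_id weyl1 weylMul.
Proof. by elim/weyl_ind=> ?; rewrite weylMulPi mulr1. Qed.
Lemma weylMulDl : left_distributive weylMul +%R.
Proof.
do 3!elim/weyl_ind=> ?.
by rewrite -weylPiD !weylMulPi -weylPiD mulrDl.
Qed.
Lemma weylMulDr : right_distributive weylMul +%R.
Proof.
do 3!elim/weyl_ind=> ?.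
by rewrite -weylPiD !weylMulPi -weylPiD mulrDr.
Qed.

(* Nontriviality: x_i and y_i act on K[X_1, ..., X_n] as the derivation d/dX_i
   and as multiplication by X_i. *)
Section Nontrivial.
Import mpoly.
Local Notation V := {mpoly K[n]}.
Let op (t : 'I_n + 'I_n) : {linear V -> V} :=
  match t with inl i => mderiv i | inr i => 'X_i \*o idfun end.

Let weylIdeal_act f : weylIdeal f -> forall v, freeAct op f v = 0.
Proof.
elim=> {f} [r rel_r | | f g _ IHf _ IHg | f g _ IHg | f g _ IHf] v.
- case: rel_r => i j; rewrite /comm !(freeActD, freeActN, freeActM, freeActG).
  + by rewrite /= mderiv_comm subrr.
  + by rewrite /= mulrCA subrr.
  have -> : freeAct op ((i == j)%:R : weylFree) v = (i == j)%:R *: v.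
    by case: (i == j); rewrite ?freeAct1 ?freeAct0 ?scale1r ?scale0r.
  rewrite /= mderivM mderivX addrK mnm1E eq_sym.
  by case: eqP => [->|_]; rewrite ?scale0r ?mul0r ?subrr // !scale1r
    -{1}[U_(_)%MM]add0m addmK mpolyX0 mul1r subrr.
- exact: freeAct0.
- by rewrite freeActD IHf IHg addr0.
- by rewrite freeActM IHg linear0.
- by rewrite freeActM IHf.
Qed.

Lemma weylOner_neq0 : weyl1 != 0.
Proof.
apply/eqP => E; have : weylIdeal (1 - 0).
  by apply/weylPiP; rewrite -/weyl1 E; apply: esym; apply: pi_zeror.
rewrite subr0 => /weylIdeal_act/(_ 1); rewrite freeAct1.
by apply/eqP/oner_neq0.
Qed.
End Nontrivial.

HB.instance Definition _ := GRing.Zmodule_isNzRing.Build weyl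
  weylMulA weylMul1l weylMul1r weylMulDl weylMulDr weylOner_neq0.

Lemma weylScaleA c d a : weylScale c (weylScale d a) = weylScale (c * d) a.
Proof. by elim/weyl_ind: a => f; rewrite !weylScalePi scalerA. Qed.
Lemma weylScale1 : left_id 1 weylScale.
Proof. by elim/weyl_ind=> f; rewrite weylScalePi scale1r. Qed.
Lemma weylScaleDr : right_distributive weylScale +%R.
Proof.
move=> c; do 2!elim/weyl_ind=> ?.
by rewrite -weylPiD !weylScalePi -weylPiD scalerDr.
Qed.
Lemma weylScaleDl a : {morph weylScale^~ a : c d / c + d}.
Proof. by move=> c d; elim/weyl_ind: a => f; rewrite !weylScalePi -weylPiD scalerDl. Qed.
HB.instance Definition _ := GRing.Zmodule_isLmodule.Build K weyl
  weylScaleA weylScale1 weylScaleDr weylScaleDl.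

Lemma weylPiM f g : weylPi (f * g) = weylPi f * weylPi g.
Proof. by rewrite -weylMulPi. Qed.
Lemma weylPiZ c f : weylPi (c *: f) = c *: weylPi f.
Proof. by rewrite -weylScalePi. Qed.

Lemma weyl_scalerAl (c : K) (a b : weyl) : c *: (a * b) = c *: a * b.
Proof.
elim/weyl_ind: a => f; elim/weyl_ind: b => g.
by rewrite -weylPiM -!weylPiZ -weylPiM scalerAl.
Qed.
HB.instance Definition _ :=
  GRing.Lmodule_isLalgebra.Build K weyl weyl_scalerAl.
Lemma weyl_scalerAr (c : K) (a b : weyl) : c *: (a * b) = a * (c *: b).
Proof.
elim/weyl_ind: a => f; elim/weyl_ind: b => g.
by rewrite -weylPiM -!weylPiZ -weylPiM scalerAr.
Qed.
HB.instance Definition _ :=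
  GRing.Lalgebra_isAlgebra.Build K weyl weyl_scalerAr.

Lemma weylPi_is_linear : linear weylPi.
Proof. by move=> c f g; rewrite weylPiD weylPiZ. Qed.
HB.instance Definition _ :=
  GRing.isLinear.Build K weylFree weyl *:%R weylPi weylPi_is_linear.
Lemma weylPi_is_monoid_morphism : monoid_morphism weylPi.
Proof. by split; [|exact: weylPiM]. Qed.
HB.instance Definition _ :=
  GRing.isMonoidMorphism.Build weylFree weyl weylPi weylPi_is_monoid_morphism.

Definition weylX (i : 'I_n) : weyl := weylPi (freeX i).
Definition weylY (i : 'I_n) : weyl := weylPi (freeY i).

Lemma weylXX i j : comm (weylX i) (weylX j) = 0.
Proof.
rewrite /comm -!rmorphM -rmorphB /= -(rmorph0 weylPi); apply/weylPiP.
by rewrite subr0; apply/WeylIdealRel/WeylXX.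
Qed.
Lemma weylYY i j : comm (weylY i) (weylY j) = 0.
Proof.
rewrite /comm -!rmorphM -rmorphB /= -(rmorph0 weylPi); apply/weylPiP.
by rewrite subr0; apply/WeylIdealRel/WeylYY.
Qed.
Lemma weylXY i j : comm (weylX i) (weylY j) = (i == j)%:R.
Proof.
rewrite /comm -!rmorphM -rmorphB /= -(rmorph_nat weylPi); apply/weylPiP.
exact/WeylIdealRel/WeylXY.
Qed.

(* The algebra morphism sending x_i to gx i and y_i to gy i, provided that gx
   and gy satisfy the defining relations. *)
Section Lift.
Variables (S : algType K) (gx gy : 'I_n -> S).

Let gen (t : 'I_n + 'I_n) : S :=
  match t with inl i => gx i | inr i => gy i end.

Definition weylLift : weyl -> S :=
  locked (fun a => freeEval gen (weylRepr a)).

Hypotheses (gxx : forall i j, comm (gx i) (gx j) = 0)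
  (gyy : forall i j, comm (gy i) (gy j) = 0)
  (gxy : forall i j, comm (gx i) (gy j) = (i == j)%:R).

Lemma weylLiftPi f : weylLift (weylPi f) = freeEval gen f.
Proof.
rewrite /weylLift -lock.
apply/eqP; rewrite -subr_eq0 -rmorphB /=; apply/eqP.
elim: {f}(_ - _) / (weylPiK f) => [r rel_r | | f g _ IHf _ IHg | f g _ IHg | f g _ IHf].
- case: rel_r => i j.
  + by rewrite rmorph_comm /= !freeEvalG; apply: gxx.
  + by rewrite rmorph_comm /= !freeEvalG; apply: gyy.
  + by rewrite rmorphB rmorph_nat /= rmorph_comm /= !freeEvalG /= gxy subrr.
- exact: rmorph0.
- by rewrite rmorphD /= IHf IHg addr0.
- by rewrite rmorphM /= IHg mulr0.
- by rewrite rmorphM /= IHf mul0r.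
Qed.

Lemma weylLift_is_linear : linear weylLift.
Proof.
move=> c a b; rewrite -[a]weylReprK -[b]weylReprK.
by rewrite -linearP !weylLiftPi linearP.
Qed.

Lemma weylLift_is_monoid_morphism : monoid_morphism weylLift.
Proof.
split; first by rewrite -(rmorph1 weylPi) weylLiftPi rmorph1.
move=> a b; rewrite -[a]weylReprK -[b]weylReprK.
by rewrite -rmorphM /= !weylLiftPi rmorphM.
Qed.

Lemma weylLiftX i : weylLift (weylX i) = gx i.
Proof. by rewrite weylLiftPi freeEvalG. Qed.
Lemma weylLiftY i : weylLift (weylY i) = gy i.
Proof. by rewrite weylLiftPi freeEvalG. Qed.
End Lift.

Section HatAlpha.
Variable k : 'rV[K]_n.

Definition hatAlpha : weyl -> weyl :=
  weylLift weylX (fun l => weylY l + (k 0 l)%:A).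

Let relYY i j : comm (weylY i + (k 0 i)%:A) (weylY j + (k 0 j)%:A) = 0.
Proof. by rewrite commDr commDl weylYY. Qed.
Let relXY i j : comm (weylX i) (weylY j + (k 0 j)%:A) = (i == j)%:R.
Proof. by rewrite commDr weylXY. Qed.

HB.instance Definition _ := GRing.isLinear.Build K weyl weyl *:%R hatAlpha
  (weylLift_is_linear weylXX relYY relXY).
HB.instance Definition _ := GRing.isMonoidMorphism.Build weyl weyl hatAlpha
  (weylLift_is_monoid_morphism weylXX relYY relXY).

Lemma hatAlphaX l : hatAlpha (weylX l) = weylX l.
Proof. exact: (weylLiftX weylXX relYY relXY). Qed.
Lemma hatAlphaY l : hatAlpha (weylY l) = weylY l + (k 0 l)%:A.
Proof. exact: (weylLiftY weylXX relYY relXY). Qed.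
End HatAlpha.
End Weyl.

HB.mixin Record isNonassocAlgebra (K : pzRingType) A of GRing.Lmodule K A := {
  na_mul : A -> A -> A;
  na_mul_linearl : forall b, linear (na_mul^~ b);
  na_mul_linearr : forall a, linear (na_mul a)
}.
#[short(type="naAlgType")]
HB.structure Definition NonassocAlgebra (K : pzRingType) :=
  {A of isNonassocAlgebra K A & GRing.Lmodule K A}.

HB.mixin Record isHomAssociative (K : pzRingType) A of NonassocAlgebra K A := {
  twist : A -> A;
  twist_linear : linear twist;
  hom_assoc : forall a b c : A,
    na_mul (twist a) (na_mul b c) = na_mul (na_mul a b) (twist c)
}.
#[short(type="homAssocAlgType")]
HB.structure Definition HomAssocAlgebra (K : pzRingType) :=
  {A of isHomAssociative K A & NonassocAlgebra K A}.

Section Nuclei.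
Local Open Scope classical_set_scope.
Variables (K : pzRingType) (A : naAlgType K).
Implicit Types a b c : A.
Local Notation "a ** b" := (na_mul a b) (at level 40, left associativity).

Definition na_comm a b : A := a ** b - b ** a.
Definition na_assoc a b c : A := (a ** b) ** c - a ** (b ** c).

Definition commuter : set A := [set a | forall b, na_comm a b = 0].
Definition lnucleus : set A := [set a | forall b c, na_assoc a b c = 0].
Definition mnucleus : set A := [set b | forall a c, na_assoc a b c = 0].
Definition rnucleus : set A := [set c | forall a b, na_assoc a b c = 0].
Definition nucleus : set A := lnucleus `&` mnucleus `&` rnucleus.
Definition na_center : set A := commuter `&` nucleus.
End Nuclei.
Arguments commuter {K} A.
Arguments lnucleus {K} A.
Arguments mnucleus {K} A.
Arguments rnucleus {K} A.
Arguments nucleus {K} A.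
Arguments na_center {K} A.

Definition homWeyl (K : fieldType) (n : nat) (k : 'rV[K]_n) : Type := weyl K n.

Section HomWeyl.
Variables (K : fieldType) (n : nat) (k : 'rV[K]_n).
Local Notation homWeyl := (homWeyl k).

HB.instance Definition _ := GRing.Lmodule.on homWeyl.

Definition homWeylMul (p q : homWeyl) : homWeyl :=
  hatAlpha k ((p : weyl K n) * (q : weyl K n)).

Lemma homWeylMul_linearl q : linear (homWeylMul^~ q).
Proof.
by move=> c a b; rewrite /homWeylMul mulrDl -scalerAl; exact: linearP.
Qed.
Lemma homWeylMul_linearr p : linear (homWeylMul p).
Proof.
by move=> c a b; rewrite /homWeylMul mulrDr -scalerAr; exact: linearP.
Qed.
HB.instance Definition _ :=
  isNonassocAlgebra.Build K homWeyl homWeylMul_linearl homWeylMul_linearr.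

Lemma hatAlpha_linear : linear (hatAlpha k : homWeyl -> homWeyl).
Proof. by move=> c a b; exact: linearP. Qed.
Lemma homWeyl_hom_assoc (a b c : homWeyl) :
  homWeylMul (hatAlpha k a) (homWeylMul b c)
  = homWeylMul (homWeylMul a b) (hatAlpha k c).
Proof. by rewrite /homWeylMul -!rmorphM /= mulrA. Qed.
HB.instance Definition _ :=
  isHomAssociative.Build K homWeyl hatAlpha_linear homWeyl_hom_assoc.

(* K, identified with K 1 where 1 is the unit of the (associative) Weyl
   algebra; homWeyl k itself is in general not unital. *)
Definition homWeylScalars : set homWeyl :=
  [set a | exists c : K, a = c%:A :> weyl K n]%classic.
End HomWeyl.
Arguments homWeylScalars {K n} k.

(* Main.v *)
(* In any Weyl algebra the operator E(a) = sum_i (y_i [x_i, a] - x_i [y_i, a])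
   multiplies an element of degree at most m (for the filtration by word length)
   by m, up to terms of degree less than m.  It kills central elements, so in
   characteristic zero they have degree 0: the center is K.  The map alpha_k is
   injective, hence C(A_n^k) is the center of A_n.  If k_l <> 0, testing
   associators on 1 and y_l forces every element of a one-sided or middle
   nucleus to be annihilated by k_l. *)
From HB Require Import structures.
Require Import Defs.
From mathcomp Require Import all_boot all_order all_algebra.
From mathcomp Require Import classical_sets.
From mathcomp Require Import monalg.

Import GRing.Theory.
Local Open Scope ring_scope.
Local Open Scope classical_set_scope.

(** * Commutation with a fixed element as a linear derivation *)

Section Commutators.
Variables (K : fieldType) (A : algType K).
Implicit Types a b c : A.

Lemma comm_linear a : linear (comm a).
Proof.
move=> t b c; rewrite /comm mulrDr mulrDl -scalerAr -scalerAl opprD addrACA.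
by rewrite scalerBr.
Qed.

HB.instance Definition _ a :=
  GRing.isLinear.Build K A A *:%R (comm a) (comm_linear a).

Lemma commMr a b c : comm a (b * c) = comm a b * c + b * comm a c.
Proof. by rewrite /comm mulrBl mulrBr !mulrA addrA subrK. Qed.

Lemma comm_scalar a (t : K) : comm a t%:A = 0.
Proof. by rewrite /comm mulr_algr mulr_algl subrr. Qed.

Lemma commC a b : comm a b = - comm b a.
Proof. by rewrite /comm opprB. Qed.

End Commutators.

Section Weyl.
Variables (K : fieldType) (n : nat).
Local Notation A := (weyl K n).
Local Notation gens := ('I_n + 'I_n)%type.
Implicit Types (a b : A) (g h : gens) (m : nat).

(** * Generators of the Weyl algebra and the filtration by degree *)

Definition weylGen g : A :=
  match g with inl i => weylX K i | inr i => weylY K i end.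

(** That these commutators are scalars is why commuting with a generator lowers the degree. *)
Lemma comm_weylGen g h : exists t : K, comm (weylGen g) (weylGen h) = t%:A.
Proof.
have natA d : (d%:R : A) = (d%:R : K)%:A by rewrite scaler_nat.
case: g h => [i|i] [j|j] /=.
- by exists 0; rewrite weylXX scale0r.
- by exists (i == j)%:R; rewrite weylXY natA.
- by exists (- (j == i)%:R); rewrite commC weylXY natA scaleNr.
- by exists 0; rewrite weylYY scale0r.
Qed.

(* The filtration by word length, shifted by one: [weylFilt m] consists of the
   elements of degree less than [m]. *)
Fixpoint weylFilt m (a : A) : Prop :=
  if m is m'.+1 then exists (t : K) (b : gens -> A),
    (forall g, weylFilt m' (b g)) /\ a = t%:A + \sum_g weylGen g * b g
  else a = 0.
Arguments weylFilt : simpl never.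

Lemma weylFilt0 m : weylFilt m 0.
Proof.
elim: m => [//|m IH]; exists 0, (fun=> 0); split=> //.
by rewrite scale0r big1 ?addr0 // => g _; rewrite mulr0.
Qed.

Lemma weylFiltP m (t : K) a b :
  weylFilt m a -> weylFilt m b -> weylFilt m (t *: a + b).
Proof.
elim: m a b => [|m IH] a b; first by move=> -> ->; rewrite scaler0 addr0.
move=> [ta [ca [Fa ->]]] [tb [cb [Fb ->]]].
exists (t * ta + tb), (fun g => t *: ca g + cb g); split=> [g|].
  exact: IH (Fa g) (Fb g).
rewrite scalerDr scalerA scalerDl -!addrA; congr (_ + _).
rewrite addrCA; congr (_ + _); rewrite scaler_sumr -big_split /=.
by apply: eq_bigr => g _; rewrite mulrDr scalerAr.
Qed.

Lemma weylFiltZ m (t : K) a : weylFilt m a -> weylFilt m (t *: a).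
Proof. by move=> Fa; rewrite -[_ *: _]addr0; apply/weylFiltP/weylFilt0. Qed.

Lemma weylFiltD m a b : weylFilt m a -> weylFilt m b -> weylFilt m (a + b).
Proof. by move=> Fa; rewrite -[a]scale1r; apply: weylFiltP. Qed.

Lemma weylFilt_sum (I : Type) (r : seq I) (P : pred I) (F : I -> A) m :
  (forall i, P i -> weylFilt m (F i)) -> weylFilt m (\sum_(i <- r | P i) F i).
Proof.
by move=> FF; apply: big_ind => //; [apply: weylFilt0 | apply: weylFiltD].
Qed.

Lemma weylFilt_scalar m (t : K) : weylFilt m.+1 t%:A.
Proof.
exists t, (fun=> 0); split=> [g|]; first exact: weylFilt0.
by rewrite big1 ?addr0 // => g _; rewrite mulr0.
Qed.

Lemma weylFiltS m a : weylFilt m a -> weylFilt m.+1 a.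
Proof.
elim: m a => [|m IH] a; first by move=> ->; apply: weylFilt0.
by move=> [t [b [Fb ->]]]; exists t, b; split=> [g|//]; exact: IH (Fb g).
Qed.

Lemma weylFilt_le m1 m2 a : (m1 <= m2)%N -> weylFilt m1 a -> weylFilt m2 a.
Proof.
move=> /subnK <-; elim: (m2 - m1)%N => [//|m IH] Fa.
by rewrite addSn; apply/weylFiltS/IH.
Qed.

Lemma weylFilt_gen m g a : weylFilt m a -> weylFilt m.+1 (weylGen g * a).
Proof.
move=> Fa; exists 0, (fun h => if h == g then a else 0); split=> [h|].
  by case: eqP => _ //; apply: weylFilt0.
rewrite scale0r add0r (bigD1 g) //= eqxx big1 ?addr0 // => h /negPf->.
exact: mulr0.
Qed.

(** By the Leibniz rule [[g, h * b]] is a scalar multiple of [b] plus [h * [g, b]]. The factor [b]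
    has already lost one degree, and [[g, b]] loses one by induction. *)
Lemma weylFilt_comm m g a : weylFilt m.+1 a -> weylFilt m (comm (weylGen g) a).
Proof.
elim: m a => [|m IH] a [t [b [Fb ->]]].
  rewrite big1 ?addr0 => [|h _]; first exact: comm_scalar.
  by rewrite Fb mulr0.
rewrite linearD /= comm_scalar add0r linear_sum /=; apply: weylFilt_sum => h _.
rewrite commMr; have [s ->] := comm_weylGen g h.
rewrite mulr_algl; apply: weylFiltD; first exact/weylFiltZ.
exact/weylFilt_gen/IH.
Qed.

(** A representative in the free algebra is a finite combination of words; a word of length [r] lies
    in level [r + 1], and a sum lies in the larger of two levels. *)
Lemma weylFilt_exhaustive a : exists m, weylFilt m a.
Proof.
rewrite -(weylReprK a); set f := weylRepr a; clearbody f.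
have word (t : K) (s : seq gens) : exists m,
    weylFilt m (weylPi (<< t *g FMonom s >> : freeAlg K gens)).
  elim: s => [|g s [m IH]].
    exists 1%N; have -> : << t *g FMonom [::] >> = t%:A :> freeAlg K gens.
      by rewrite -mul_malgC mulr1; congr (<< _ *g _ >>); apply/val_inj; rewrite /= fm1.
    by rewrite linearZ /= rmorph1; apply: weylFilt_scalar.
  exists m.+1; have -> : (<< t *g FMonom (g :: s) >> : freeAlg K gens)
    = freeGen K g * << t *g FMonom s >>.
    rewrite /freeGen malgM_def fgmulUU mul1r; congr (<< _ *g _ >>).
    by apply/val_inj; rewrite /= fmM fmU.
  rewrite weylPiM; have -> : weylPi (freeGen K g) = weylGen g by case: g.
  exact: weylFilt_gen.
rewrite [f]monalgE linear_sum.
apply: (big_ind (fun b => exists m, weylFilt m b)) => [|b c [m1 F1] [m2 F2]|[s] _].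
- by exists 0%N.
- exists (maxn m1 m2); apply: weylFiltD.
    exact: weylFilt_le (leq_maxl _ _) F1.
  exact: weylFilt_le (leq_maxr _ _) F2.
- exact: word.
Qed.

(** Induction on the filtration level, each level being built from scalars, sums and left
    multiplication by generators. *)
Lemma weyl_gen_ind (P : A -> Prop) :
  (forall t : K, P t%:A) -> (forall a b, P a -> P b -> P (a + b)) ->
  (forall g a, P a -> P (weylGen g * a)) -> forall a, P a.
Proof.
move=> Pt PD PM a; have [m] := weylFilt_exhaustive a.
have P0 : P 0 by rewrite -(scale0r 1).
elim: m a => [a ->|m IH a] //.
move=> [t [b [Fb ->]]]; apply: (PD) => //; apply: (big_ind P) => // g _.
exact: PM (IH _ (Fb g)).
Qed.

(** * The Euler operator and its action on the filtration *)

(** Commuting with [x_i] acts as d/dy_i and commuting with [y_i] as -d/dx_i, so this is the analogue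
    of the Euler vector field, with its coefficients placed on the left. *)
Definition weylEuler a : A :=
  \sum_i (weylY K i * comm (weylX K i) a - weylX K i * comm (weylY K i) a).

Lemma weylEuler_linear : linear weylEuler.
Proof.
move=> t a b; rewrite /weylEuler scaler_sumr -big_split; apply: eq_bigr => i _.
have L x y : x * comm y (t *: a + b) = t *: (x * comm y a) + x * comm y b.
  by rewrite linearP mulrDr scalerAr.
by rewrite !L scalerBr opprD addrACA.
Qed.

HB.instance Definition _ :=
  GRing.isLinear.Build K A A *:%R weylEuler weylEuler_linear.

Lemma weylEuler_scalar (t : K) : weylEuler t%:A = 0.
Proof. by rewrite /weylEuler big1 // => i _; rewrite !comm_scalar !mulr0 subrr. Qed.

Lemma weylEuler_gen g : weylEuler (weylGen g) = weylGen g.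
Proof.
case: g => j; rewrite /weylEuler (bigD1 j) //= big1 ?addr0 => [|i /negPf ij].
- by rewrite weylXX (commC _ _ (weylY K j)) weylXY eqxx mulr0 mulrN opprK mulr1 add0r.
- by rewrite weylXX (commC _ _ (weylY K i)) weylXY eq_sym ij oppr0 !mulr0 subrr.
- by rewrite weylXY weylYY eqxx mulr1 mulr0 subr0.
- by rewrite weylXY weylYY ij !mulr0 subrr.
Qed.

(** The operator fails to be a derivation only because its left coefficients [y_i] and [x_i] must be
    moved past [a]; this produces the products of commutators. *)
Lemma weylEulerM a b : weylEuler (a * b) = weylEuler a * b + a * weylEuler b
  + \sum_i (comm (weylY K i) a * comm (weylX K i) b
            - comm (weylX K i) a * comm (weylY K i) b).
Proof.
rewrite /weylEuler mulr_suml mulr_sumr -!big_split; apply: eq_bigr => i _ /=.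
have L x y : x * comm y (a * b)
    = x * comm y a * b + a * (x * comm y b) + comm x a * comm y b.
  rewrite commMr mulrDr !mulrA -addrA; congr (_ + _).
  by rewrite -mulrDl [comm x a]/comm addrCA subrr addr0.
rewrite !L; do 4!move: (comm _ _) => ?.
by rewrite mulrBl mulrBr !opprD (addrACA (_ + _)) (addrACA (_ * _ * b)).
Qed.

(** Induction on the degree: in the product rule for [h * b], the generator [h] has eigenvalue 1 and
    [b] contributes [m] up to lower terms, while the correction terms are scalars times commutators
    of [b]. *)
Lemma weylFilt_Euler m a :
  weylFilt m.+1 a -> weylFilt m (weylEuler a - m%:R *: a).
Proof.
elim: m a => [|m IH] a [t [b [Fb ->]]].
  rewrite big1 ?addr0 => [|h _]; first by rewrite weylEuler_scalar scale0r subrr.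
  by rewrite Fb mulr0.
rewrite linearD linear_sum [_ t%:A]weylEuler_scalar add0r scalerDr opprD addrCA.
(* The operator kills the constant term, so what is left of it is a scalar, which every positive
   level contains. *)
rewrite -scaleNr; apply: weylFiltD; first exact/weylFiltZ/weylFilt_scalar.
rewrite scaler_sumr -sumrB; apply: weylFilt_sum => h _.
have -> : weylEuler (weylGen h * b h) - m.+1%:R *: (weylGen h * b h)
    = weylGen h * (weylEuler (b h) - m%:R *: b h)
      + \sum_i (comm (weylY K i) (weylGen h) * comm (weylX K i) (b h)
            - comm (weylX K i) (weylGen h) * comm (weylY K i) (b h)).
  rewrite weylEulerM weylEuler_gen addrAC; congr (_ + _).
  by rewrite mulrS scalerDl scale1r mulrBr -scalerAr opprD addrACA subrr
    add0r.
apply: weylFiltD; first exact/weylFilt_gen/IH.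
have Fc g : weylFilt m.+1 (comm (weylGen g) (b h)).
  exact/weylFiltS/weylFilt_comm.
apply: weylFilt_sum => i _; apply: weylFiltD.
  have [s E] := comm_weylGen (inr i) h; rewrite /= in E.
  by rewrite E mulr_algl; apply/weylFiltZ/(Fc (inl i)).
have [s E] := comm_weylGen (inl i) h; rewrite /= in E.
by rewrite E mulr_algl -scaleNr; apply/weylFiltZ/(Fc (inr i)).
Qed.

(** * The center of the Weyl algebra in characteristic zero *)

Lemma weyl_center a : [pchar K] =i pred0 ->
  (forall b, comm a b = 0) -> exists t : K, a = t%:A.
Proof.
move=> charK0 Ca; have [m Fa] := weylFilt_exhaustive a.
(* With the index raised by one, the descent stops at level 1, which consists of the scalars. *)
have {Fa} : weylFilt m.+1 a by apply: weylFiltS.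
have Ea : weylEuler a = 0.
  by rewrite /weylEuler big1 // => i _; rewrite !(commC _ _ _ a) !Ca oppr0 !mulr0 subrr.
elim: m => [[t [b [Fb ->]]]|m IH Fa].
  by exists t; rewrite big1 ?addr0 // => g _; rewrite Fb mulr0.
(* As [weylEuler a] vanishes, the multiple [- m.+1%:R *: a] lies one level lower; characteristic
   zero allows division. *)
apply: IH; have m_neq0 : m.+1%:R != 0 :> K by rewrite (pcharf0P _).1.
have := weylFilt_Euler _ _ Fa; rewrite Ea sub0r -scaleNr.
by move=> /(weylFiltZ _ (- m.+1%:R^-1)); rewrite scalerA mulrNN mulVf // scale1r.
Qed.

(** * Inverse shifts and the trivial shift *)

(** The shifts by [k] and [- k] cancel on generators, hence everywhere; this is the source of
    injectivity. *)
Lemma hatAlphaNK (k : 'rV[K]_n) : cancel (hatAlpha k) (hatAlpha (- k)).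
Proof.
elim/weyl_gen_ind => [t|a b IHa IHb|g a IH].
- by rewrite !linearZ /= !rmorph1.
- by rewrite !rmorphD /= IHa IHb.
rewrite !rmorphM /= IH; congr (_ * _).
case: g => i /=; first by rewrite !hatAlphaX.
by rewrite hatAlphaY rmorphD /= hatAlphaY linearZ /= rmorph1 mxE scaleNr subrK.
Qed.

Lemma hatAlpha0 a : hatAlpha 0 a = a.
Proof.
elim/weyl_gen_ind: a => [t|a b IHa IHb|g a IH].
- by rewrite linearZ /= rmorph1.
- by rewrite rmorphD /= IHa IHb.
rewrite rmorphM /= IH; congr (_ * _).
by case: g => i /=; rewrite ?hatAlphaX // hatAlphaY mxE scale0r addr0.
Qed.

End Weyl.

(** * Commuter, nuclei and center of the hom-associative algebra *)

Section HomWeyl.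
Variables (K : fieldType) (n : nat) (k : 'rV[K]_n).
Local Notation A := (weyl K n).
Local Notation alpha := (hatAlpha k).

Lemma hatAlpha_eq0 (a : A) : alpha a = 0 <-> a = 0.
Proof.
split=> [E|->]; last exact: rmorph0.
by apply: (can_inj (hatAlphaNK _ _ k)); rewrite rmorph0.
Qed.

(** Both bracketings carry an outer [alpha], which injectivity removes; the inner one distributes
    over its product by multiplicativity. *)
Lemma na_assoc_homWeyl (a b c : homWeyl k) : na_assoc a b c = 0 <->
  alpha a * alpha b * c = a * (alpha b * alpha c) :> A.
Proof.
have -> : na_assoc a b c
    = alpha (alpha a * alpha b * (c : A) - (a : A) * (alpha b * alpha c)).
  by rewrite -!(rmorphM alpha) rmorphB.
split=> [/hatAlpha_eq0/subr0_eq //|->].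
by apply/hatAlpha_eq0; rewrite subrr.
Qed.

Lemma na_comm_homWeyl (a b : homWeyl k) :
  na_comm a b = 0 <-> comm (a : A) b = 0.
Proof.
have -> : na_comm a b = alpha (comm (a : A) b) by rewrite /comm rmorphB.
exact: hatAlpha_eq0.
Qed.

Lemma commuter_homWeyl : [pchar K] =i pred0 ->
  commuter (homWeyl k) = homWeylScalars k.
Proof.
move=> charK0; apply/seteqP; split=> a.
  by move=> Ca; apply: weyl_center => // b; apply/na_comm_homWeyl/Ca.
by move=> [t ->] b; apply/na_comm_homWeyl; rewrite commC comm_scalar oppr0.
Qed.

Lemma na_assoc_homWeyl0 (a b c : homWeyl k) : k = 0 -> na_assoc a b c = 0.
Proof. by move=> k0; apply/na_assoc_homWeyl; rewrite k0 !hatAlpha0 mulrA. Qed.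

Section Nonzero.
Variable l : 'I_n.
Hypothesis kl_neq0 : k 0 l != 0.
Local Notation y := (weylY K l : homWeyl k).
Local Notation one := (1 : A).

Lemma lnucleus_homWeyl (a : homWeyl k) : lnucleus (homWeyl k) a -> a = 0.
Proof.
(* The pair [(1, 1)] gives [alpha a = a]; then [(1, y)] gives [a * y = a * (y + k_l)], so [k_l]
   kills [a]. *)
move=> Na; have := Na one one; have := Na one y.
move=> /na_assoc_homWeyl E /na_assoc_homWeyl; move: E.
rewrite !rmorph1 !mulr1 !mul1r => + E; rewrite E hatAlphaY mulrDr mulr_algr.
move=> /eqP; rewrite -subr_eq0 opprD addrA subrr sub0r oppr_eq0 scaler_eq0.
by rewrite (negPf kl_neq0) => /eqP.
Qed.

Lemma rnucleus_homWeyl (c : homWeyl k) : rnucleus (homWeyl k) c -> c = 0.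
Proof.
(* Mirror image: [(1, 1)] gives [c = alpha c], and [(y, 1)] gives [(y + k_l) * c = y * c]. *)
move=> Nc; have := Nc one one; have := Nc y one.
move=> /na_assoc_homWeyl E /na_assoc_homWeyl; move: E.
rewrite !rmorph1 !mulr1 !mul1r => + E; rewrite -E hatAlphaY mulrDl mulr_algl.
move=> /eqP; rewrite -subr_eq0 addrAC subrr add0r scaler_eq0.
by rewrite (negPf kl_neq0) => /eqP.
Qed.

Lemma mnucleus_homWeyl (b : homWeyl k) : mnucleus (homWeyl k) b -> b = 0.
Proof.
(* Here [alpha b] occurs on both sides, so one associator shows that [k_l] kills [alpha b], and
   injectivity gives [b = 0]. *)
move=> Nb; have /na_assoc_homWeyl := Nb one y.
rewrite rmorph1 !mul1r hatAlphaY mulrDr mulr_algr.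
move=> /eqP; rewrite -subr_eq0 opprD addrA subrr sub0r oppr_eq0 scaler_eq0.
by rewrite (negPf kl_neq0) => /eqP/hatAlpha_eq0.
Qed.

End Nonzero.
End HomWeyl.

Theorem theorem3 (K : fieldType) (n : nat) (k : 'rV[K]_n)
    (charK0 : [pchar K] =i pred0) (n_ge1 : (1 <= n)%N) :
  [/\ commuter (homWeyl k) = homWeylScalars k,
      [/\ nucleus (homWeyl k) = lnucleus (homWeyl k),
          lnucleus (homWeyl k) = mnucleus (homWeyl k),
          mnucleus (homWeyl k) = rnucleus (homWeyl k)
        & nucleus (homWeyl k) = if k == 0 then [set: homWeyl k] else [set 0]]
    & na_center (homWeyl k) =
        if k == 0 then homWeylScalars k else [set 0]].
Proof.
have CK := commuter_homWeyl _ _ k charK0.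
rewrite /na_center CK /nucleus; case: eqVneq => [k0|k_neq0].
  (* For [k = 0] the twist is the identity and the product is the associative one, so every
     associator vanishes. *)
  have T (P : set (homWeyl k)) : (forall a, P a) -> P = setT.
    by move=> PT; apply/seteqP; split.
  have -> : lnucleus (homWeyl k) = setT by apply: T => a b c; apply: na_assoc_homWeyl0.
  have -> : mnucleus (homWeyl k) = setT by apply: T => a b c; apply: na_assoc_homWeyl0.
  have -> : rnucleus (homWeyl k) = setT by apply: T => a b c; apply: na_assoc_homWeyl0.
  by rewrite !setIT.
have [l kl] : exists l, k 0 l != 0 by apply/rV0Pn.
have T (P : set (homWeyl k)) : P 0 -> (forall a, P a -> a = 0) -> P = [set 0].
  by move=> P0 PT; apply/seteqP; split=> [a /PT|a ->].
have -> : lnucleus (homWeyl k) = [set 0].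
  apply: T => [b c|]; last exact: lnucleus_homWeyl kl.
  by apply/na_assoc_homWeyl; rewrite rmorph0 !mul0r.
have -> : mnucleus (homWeyl k) = [set 0].
  apply: T => [b c|]; last exact: mnucleus_homWeyl kl.
  by apply/na_assoc_homWeyl; rewrite rmorph0 !mulr0 !mul0r mulr0.
have -> : rnucleus (homWeyl k) = [set 0].
  apply: T => [b c|]; last exact: rnucleus_homWeyl kl.
  by apply/na_assoc_homWeyl; rewrite rmorph0 !mulr0.
(* What remains is the center, the intersection of the scalars with the zero nucleus. *)
rewrite !setIid; split=> //; apply: T => [|a [_]] //.
by split=> //; exists 0; rewrite scale0r.
Qed.
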